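(* Let $K$ be a field of characteristic $0$, $G$ a finite abelian group, and let $\rho:\mathsf G\to\mathsf E$ be a graded map satisfying the restriction property (RP). Let $n\in\mathbb{N}$. For all $e\in E_n$, $$\Delta(\mathsf b^{\rho}_e)=\sum_{i=0}^n\ \sum_{(e_1,e_2)\in E_i\times E_{n-i}} a^e_{e_1,e_2}\ \mathsf b^{\rho}_{e_1}\otimes\mathsf b^{\rho}_{e_2}.$$ In particular, $\mathcal E(\rho)$ is a subcoalgebra of $(K[\mathsf G],\Delta)$.
   Context: $G_n=G^n\rtimes\mathfrak S_n$ is the wreath product; its elements are written $\sigma^{\mathbf g}=\sigma\cdot(g_1,\dots,g_n)$ and identified with coloured words $\sigma(1)^{g_1}\cdots\sigma(n)^{g_n}$; multiplication is determined by $\sigma\cdot(g_1,\dots,g_n)=(g_{\sigma^{-1}(1)},\dots,g_{\sigma^{-1}(n)})\cdot\sigma$, and $\mathfrak S_n\subseteq G_n$ via $\sigma\mapsto\sigma\cdot(1,\dots,1)$. $\mathsf G=\bigsqcup_{n\ge0}G_n$, $K[\mathsf G]=\bigoplus_{n\ge0}KG_n$. A graded set is $\mathsf E=\bigsqcup_{n\ge 0}E_n$; a graded map $\rho:\mathsf G\to\mathsf E$ satisfies $\rho(G_n)\subseteq E_n$. For $e\in E_n$, $\mathsf b^\rho_e=\sum_{\alpha\in G_n,\ \rho(\alpha)=e}\alpha\in KG_n$; $\mathcal E(\rho)_n$ is the span of the $\mathsf b_e^\rho$, $e\in E_n$, and $\mathcal E(\rho)=\bigoplus_n\mathcal E(\rho)_n$.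 For $\sigma\in\mathfrak S_n$, $\tau\in\mathfrak S_m$, $\sigma\times\tau\in\mathfrak S_{n+m}$ maps $a\in[1,n]$ to $\sigma(a)$ and $n+b$ ($b\in[1,m]$) to $n+\tau(b)$; $\sigma^{\mathbf g}\times\tau^{\mathbf h}=(\sigma\times\tau)^{\mathbf g\cdot\mathbf h}$ ($\mathbf g\cdot\mathbf h$ concatenation). $X_{(n,m)}$ is the set of $u\in\mathfrak S_{n+m}$ increasing on $[1,n]$ and on $[n+1,n+m]$. Every element of $G_{n+m}$ is uniquely $u(\alpha\times\beta)$ with $u\in X_{(n,m)}$, $\alpha\in G_n$, $\beta\in G_m$. Coproduct: for $\alpha\in G_n$ and $i\in[0,n]$, let $\alpha_{(i)}\in G_i$, $\alpha_{(n-i)}\in G_{n-i}$ be the unique elements with $\alpha^{-1}=u(\alpha_{(i)}\times\alpha_{(n-i)})^{-1}$ for some $u\in X_{(i,n-i)}$. Then $\Delta(\alpha)=\sum_{i=0}^n\alpha_{(i)}\otimes\alpha_{(n-i)}$. (The decomposition for index $i$ determines both tensor factors.) (RP): for any $n,m\in\mathbb{N}$ and $u\in X_{(n,m)}$, if $\alpha_1,\alpha_2\in G_n$ and $\beta_1,\beta_2\in G_m$ are such that $\rho(\alpha_1)=\rho(\alpha_2)$ and $\rho(\beta_1)=\rho(\beta_2)$, then $\rho((\alpha_1\times\beta_1)u^{-1})=\rho((\alpha_2\times\beta_2)u^{-1})$. For $e\in E_n$, $i\in[0,n]$ and $(\beta_1,\beta_2)\in G_i\times G_{n-i}$ let $A^e_{\beta_1,\beta_2}=\{\alpha\in\rho^{-1}(e):\alpha_{(i)}\times\alpha_{(n-i)}=\beta_1\times\beta_2\}$.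 For $(e_1,e_2)\in E_i\times E_{n-i}$, $a^e_{e_1,e_2}=|A^e_{\beta_1,\beta_2}|$ for any $(\beta_1,\beta_2)\in\rho^{-1}(e_1)\times\rho^{-1}(e_2)$; under (RP) this cardinality depends only on $e,e_1,e_2$. If $\rho^{-1}(e_1)\times\rho^{-1}(e_2)$ is empty, put $a^e_{e_1,e_2}=0$. *)

(* Defs.v *)
From HB Require Import structures.
From mathcomp Require Import all_boot all_order all_algebra all_fingroup.
From mathcomp Require Import finmap monalg.
From mathcomp Require Import boolp classical_sets cardinality fsbigop.

Set Implicit Arguments.
Unset Strict Implicit.
Unset Printing Implicit Defensive.

Import GRing.Theory.
Local Open Scope ring_scope.

(* The permutation of [1, n + m] acting as s on [1, n] and as t on the rest. *)
Section BlockPerm.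
Variables (n m : nat) (s : 'S_n) (t : 'S_m).

Definition block_fun (k : 'I_(n + m)) : 'I_(n + m) :=
  match fintype.split k with
  | inl a => lshift m (s a)
  | inr b => rshift n (t b)
  end.

Lemma block_fun_inj : injective block_fun.
Proof.
move=> k l; rewrite /block_fun -[k]splitK -[l]splitK !unsplitK.
case: (fintype.split k) => a; case: (fintype.split l) => b /=.
- by move/lshift_inj/perm_inj->.
- by move/eqP; rewrite eq_lrshift.
- by move/eqP; rewrite eq_rlshift.
- by move/rshift_inj/perm_inj->.
Qed.

Definition block_perm : 'S_(n + m) := perm block_fun_inj.

End BlockPerm.

Definition shuffles (n m : nat) : {set 'S_(n + m)} :=
  [set u : 'S_(n + m) |
    [forall i : 'I_n, forall j : 'I_n,
       (i < j)%N ==> (u (lshift m i) < u (lshift m j))%N] &&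
    [forall i : 'I_m, forall j : 'I_m,
       (i < j)%N ==> (u (rshift n i) < u (rshift n j))%N]].

(* The element sigma . (g_1, ..., g_n) of the wreath product of G by S_n. *)
Record wreath (G : finGroupType) (n : nat) : predArgType :=
  Wreath { wperm : 'S_n; wcol : {ffun 'I_n -> G} }.

Section WreathGroup.
Variables (G : finGroupType) (n : nat).
Implicit Types a b c : wreath G n.

Definition wreath_pair a := (wperm a, wcol a).
Definition pair_wreath (p : 'S_n * {ffun 'I_n -> G}) := Wreath p.1 p.2.
Lemma wreath_pairK : cancel wreath_pair pair_wreath. Proof. by case. Qed.

HB.instance Definition _ := Finite.copy (wreath G n) (can_type wreath_pairK).

Lemma wreathP a b : wperm a = wperm b -> wcol a =1 wcol b -> a = b.
Proof. by case: a b => s g [t h] /= -> /ffunP->. Qed.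

(* Permutations compose from right to left in (sigma g) (tau h), whereas
   (s * t)%g applies s first in MathComp.  The colours follow from
   g . tau = tau . (g_tau(1), ..., g_tau(n)). *)
Definition wreath_mul a b : wreath G n :=
  Wreath (wperm b * wperm a)%g [ffun i => wcol a (wperm b i) * wcol b i]%g.
Definition wreath_one : wreath G n := Wreath 1%g [ffun=> 1%g].
Definition wreath_inv a : wreath G n :=
  Wreath (wperm a)^-1%g [ffun i => (wcol a ((wperm a)^-1 i))^-1]%g.

Lemma wreath_mulA : associative wreath_mul.
Proof.
by move=> a b c; apply: wreathP => [|i] /=; rewrite ?mulgA // !ffunE permM mulgA.
Qed.

Lemma wreath_mul1 : left_id wreath_one wreath_mul.
Proof. by move=> a; apply: wreathP => [|i] /=; rewrite ?mulg1 // !ffunE mul1g. Qed.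

Lemma wreath_mulV : left_inverse wreath_one wreath_inv wreath_mul.
Proof.
by move=> a; apply: wreathP => [|i] /=; rewrite ?mulgV // !ffunE permK mulVg.
Qed.

HB.instance Definition _ := Finite_isGroup.Build (wreath G n)
  wreath_mulA wreath_mul1 wreath_mulV.

Definition of_perm (s : 'S_n) : wreath G n := Wreath s [ffun=> 1%g].

End WreathGroup.

Definition wcross (G : finGroupType) (n m : nat)
    (a : wreath G n) (b : wreath G m) : wreath G (n + m) :=
  Wreath (block_perm (wperm a) (wperm b))
    [ffun k => match fintype.split k with
               | inl i => wcol a i
               | inr j => wcol b j
               end].

Notation wreaths G := {n : nat & wreath G n}.
Section Decomposition.
Variables (n m : nat).

Lemma block_perml (s : 'S_n) (t : 'S_m) i :
  block_perm s t (lshift m i) = lshift m (s i).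
Proof. by rewrite permE /block_fun (unsplitK (inl i)). Qed.

Lemma block_permr (s : 'S_n) (t : 'S_m) j :
  block_perm s t (rshift n j) = rshift n (t j).
Proof. by rewrite permE /block_fun (unsplitK (inr j)). Qed.

Lemma shufflesP (u : 'S_(n + m)) :
  reflect ((forall i j : 'I_n, i < j -> u (lshift m i) < u (lshift m j)) /\
           (forall i j : 'I_m, i < j -> u (rshift n i) < u (rshift n j)))%N
          (u \in shuffles n m).
Proof.
rewrite inE; apply: (iffP andP) => -[ul ur]; split.
- by move=> i j ij; move/forallP/(_ i)/forallP/(_ j)/implyP: ul; apply.
- by move=> i j ij; move/forallP/(_ i)/forallP/(_ j)/implyP: ur; apply.
- by apply/forallP => i; apply/forallP => j; apply/implyP/ul.
- by apply/forallP => i; apply/forallP => j; apply/implyP/ur.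
Qed.

Lemma incr_perm1 k (s : 'S_k) : (forall i j : 'I_k, i < j -> s i < s j)%N -> s = 1%g.
Proof.
have ge_id (t : 'S_k) (i : 'I_k) : (forall i j : 'I_k, i < j -> t i < t j)%N -> (i <= t i)%N.
  move=> tincr; case: i => i; elim: i => //= i IHi ik.
  by apply: leq_ltn_trans (IHi (ltnW ik)) (tincr _ _ _).
move=> sincr; apply/permP => i; rewrite perm1; apply/val_inj/anti_leq.
rewrite ge_id // andbT.
have/(ge_id _ (s i)) : (forall i j : 'I_k, i < j -> (s^-1)%g i < (s^-1)%g j)%N.
  move=> a b ab; rewrite ltnNge leq_eqVlt; apply/negP => /orP[/eqP/val_inj/perm_inj ba|].
    by rewrite ba ltnn in ab.
  by move/sincr; rewrite !permKV ltnNge ltnW.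
by rewrite permK.
Qed.

Lemma rank_perm k (f : 'I_k -> 'I_(n + m)) : injective f ->
  exists s : 'S_k, forall i j, (s i < s j)%N = (f i < f j)%N.
Proof.
move=> f_inj; pose A i := [set l | (f l < f i)%N].
have ltA i j : (f i < f j)%N -> (#|A i| < #|A j|)%N.
  move=> ij; apply: proper_card; apply/properP; split.
    by apply/fintype.subsetP => l; rewrite !inE => /ltn_trans; apply.
  by exists i; rewrite !inE ?ltnn.
have ltAE i j : (#|A i| < #|A j|)%N = (f i < f j)%N.
  case: (ltngtP (f i) (f j)) => [/ltA //|/ltA/ltnW|/val_inj/f_inj->]; last exact: ltnn.
  by rewrite ltnNge => ->.
have Ak i : (#|A i| < k)%N.
  rewrite -[X in (_ < X)%N]card_ord -cardsT; apply: proper_card; apply/properP.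
  by split=> //; exists i; rewrite !inE ?ltnn.
have s_inj : injective (fun i => Ordinal (Ak i)).
  move=> i j [] Aij; apply: f_inj; apply: val_inj.
  by case: (ltngtP (f i) (f j)) => // /ltA; rewrite Aij ltnn.
by exists (perm s_inj) => i j; rewrite !permE /= ltAE.
Qed.

Variable G : finGroupType.
Implicit Types (a : wreath G n) (b : wreath G m).

Lemma wcrossM a1 a2 b1 b2 :
  (wcross a1 b1 * wcross a2 b2 = wcross (a1 * a2)%g (b1 * b2)%g)%g.
Proof.
apply: wreathP => [|k] /=.
  apply/permP => k; rewrite permM -[k]splitK; case: (fintype.split k) => i /=.
    by rewrite !block_perml permM.
  by rewrite !block_permr permM.
rewrite !ffunE -[k]splitK; case: (fintype.split k) => i /=.
  by rewrite block_perml !(unsplitK (inl _)) ffunE.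
by rewrite block_permr !(unsplitK (inr _)) ffunE.
Qed.

Lemma wcross1 : wcross 1%g 1%g = 1%g :> wreath G (n + m).
Proof.
apply: wreathP => [|k] /=; last by rewrite !ffunE; case: fintype.split => i; rewrite ffunE.
apply/permP => k; rewrite perm1 -[k]splitK; case: (fintype.split k) => i /=.
  by rewrite block_perml perm1.
by rewrite block_permr perm1.
Qed.

Lemma wcrossV a b : (wcross a b)^-1%g = wcross a^-1%g b^-1%g.
Proof. by apply: (mulIg (wcross a b)); rewrite wcrossM !mulVg wcross1. Qed.

Lemma wcross_inj a1 a2 b1 b2 : wcross a1 b1 = wcross a2 b2 -> a1 = a2 /\ b1 = b2.
Proof.
move=> [/permP sE /ffunP gE]; split; apply: wreathP => [|i].
- by apply/permP => i; have /lshift_inj := etrans (esym (block_perml _ _ i))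
    (etrans (sE (lshift m i)) (block_perml _ _ i)).
- by have := gE (lshift m i); rewrite !ffunE (unsplitK (inl i)).
- by apply/permP => i; have /rshift_inj := etrans (esym (block_permr _ _ i))
    (etrans (sE (rshift n i)) (block_permr _ _ i)).
- by have := gE (rshift n i); rewrite !ffunE (unsplitK (inr i)).
Qed.

Lemma shuffle_decomposition (w : wreath G (n + m)) :
  exists u a b, u \in shuffles n m /\ w = (of_perm G u * wcross a b)%g.
Proof.
have [s sE] := rank_perm (inj_comp (@perm_inj _ (wperm w)) (@lshift_inj n m)).
have [t tE] := rank_perm (inj_comp (@perm_inj _ (wperm w)) (@rshift_inj n m)).
pose u := ((block_perm s t)^-1 * wperm w)%g.
exists u, (Wreath s [ffun i => wcol w (lshift m i)]),
  (Wreath t [ffun j => wcol w (rshift n j)]); split.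
  have ul i : u (lshift m (s i)) = wperm w (lshift m i).
    by rewrite permM -(block_perml s t) permK.
  have ur i : u (rshift n (t i)) = wperm w (rshift n i).
    by rewrite permM -(block_permr s t) permK.
  apply/shufflesP; split=> i j.
    by rewrite -(permKV s i) -(permKV s j) !ul sE.
  by rewrite -(permKV t i) -(permKV t j) !ur tE.
apply: wreathP => [|k] /=; first by rewrite mulKVg.
rewrite !ffunE mul1g -[k]splitK; case: (fintype.split k) => i /=.
  by rewrite (unsplitK (inl i)) ffunE.
by rewrite (unsplitK (inr i)) ffunE.
Qed.

Lemma shuffle_decomposition_uniq u1 u2 a1 a2 b1 b2 :
  u1 \in shuffles n m -> u2 \in shuffles n m ->
  (of_perm G u1 * wcross a1 b1 = of_perm G u2 * wcross a2 b2)%g ->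
  [/\ u1 = u2, a1 = a2 & b1 = b2].
Proof.
move=> /shufflesP[u1l u1r] /shufflesP[u2l u2r] uE.
pose x := (a2 * a1^-1)%g; pose y := (b2 * b1^-1)%g.
have u12 : of_perm G u1 = (of_perm G u2 * wcross x y)%g.
  by rewrite -wcrossM -wcrossV mulgA -uE mulgK.
have uxy : u1 = (block_perm (wperm x) (wperm y) * u2)%g by case: u12.
have ltr (k : nat) (s : 'S_k) (f1 f2 : 'I_k -> nat) :
    (forall i j : 'I_k, i < j -> f1 i < f1 j)%N -> (forall i j : 'I_k, i < j -> f2 i < f2 j)%N ->
    (forall i, f1 i = f2 (s i)) -> s = 1%g.
  move=> f1I f2I fE; apply: incr_perm1 => i j ij; move: (f1I _ _ ij); rewrite !fE.
  case: (ltngtP (s i) (s j)) => [//|/f2I|/val_inj->]; last by rewrite ltnn.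
  by move=> /ltnW; rewrite leqNgt => /negbTE->.
have x1 : wperm x = 1%g.
  apply: ltr u1l u2l _ => i; by rewrite uxy permM block_perml.
have y1 : wperm y = 1%g.
  apply: ltr u1r u2r _ => i; by rewrite uxy permM block_permr.
have uu : u1 = u2.
  apply/permP => k; rewrite uxy permM x1 y1 -[k]splitK.
  by case: (fintype.split k) => i /=; rewrite ?block_perml ?block_permr perm1.
by move: uE; rewrite uu => /mulgI/wcross_inj[].
Qed.

End Decomposition.

(* [splitting a i] is (a_(i), a_(n-i)).  Both sides of the defining equation
   are compared in the disjoint union of all the G_n, because i + (n - i) and n
   are not convertible.  For i <= n exactly one pair satisfies it, so that the
   default value (1, 1) plays no role: see [splittingP]. *)
Definition splitting (G : finGroupType) (n : nat) (a : wreath G n) (i : nat) :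
    wreath G i * wreath G (n - i) :=
  odflt (1%g, 1%g)
    [pick p : wreath G i * wreath G (n - i) |
      [exists u in shuffles i (n - i),
        Tagged (wreath G) a^-1%g ==
        Tagged (wreath G) (of_perm G u * (wcross p.1 p.2)^-1)%g]].

Lemma splittingP (G : finGroupType) (n : nat) (a : wreath G n) (i : nat)
    (b : wreath G i) (c : wreath G (n - i)) : (i <= n)%N ->
  splitting a i = (b, c) <->
  exists2 u, u \in shuffles i (n - i) &
    Tagged (wreath G) a^-1%g =
    Tagged (wreath G) (of_perm G u * (wcross b c)^-1)%g.
Proof.
move=> lein; rewrite /splitting; set P := fun p : _ * _ => _.
have TagW k (x y : wreath G k) :
  Tagged (wreath G) x = Tagged (wreath G) y -> x = y.
  by move/eqP; rewrite -tag_eqE /tag_eq eqxx tagged_asE => /eqP.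
have PE p : P p <-> exists2 u, u \in shuffles i (n - i) &
    Tagged (wreath G) a^-1%g =
    Tagged (wreath G) (of_perm G u * (wcross p.1 p.2)^-1)%g.
  split; first by case/exists_inP => u uX /eqP; exists u.
  by case=> u uX /eqP uE; apply/exists_inP; exists u.
have Puniq p q : P p -> P q -> p = q.
  move=> /PE[u uX e1] /PE[v vX]; rewrite e1 => /TagW; rewrite !wcrossV.
  case/(shuffle_decomposition_uniq uX vX) => _ /invg_inj h1 /invg_inj h2.
  by rewrite [p]surjective_pairing h1 h2 -surjective_pairing.
rewrite -(PE (b, c)); case: pickP => [p Pp|noP] /=.
  by split=> [<- //|Pbc]; apply: Puniq.
have [w wE] : exists w : wreath G (i + (n - i)),
    Tagged (wreath G) a^-1%g = Tagged (wreath G) w.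
  by rewrite subnKC //; exists a^-1%g.
have [u [x [y [uX uE]]]] := shuffle_decomposition w.
suff /(PE (x^-1, y^-1)%g) Pxy : exists2 v, v \in shuffles i (n - i) &
    Tagged (wreath G) a^-1%g =
    Tagged (wreath G) (of_perm G v * (wcross x^-1%g y^-1%g)^-1)%g.
  by have := noP (x^-1, y^-1)%g; rewrite Pxy.
by exists u => //; rewrite wE uE -wcrossV invgK.
Qed.

(* The K-vector space K[T] with basis T is {malg K[T]}. *)
Section FreeModule.
Variables (K : fieldType) (T : choiceType).

Definition linear_ext (V : lmodType K) (f : T -> V) (x : {malg K[T]}) : V :=
  \sum_(t <- msupp x) x@_t *: f t.

Lemma linear_extEw (V : lmodType K) (f : T -> V) (x : {malg K[T]})
    (A : {fset T}) :
  (msupp x `<=` A)%fset -> linear_ext f x = \sum_(t <- A) x@_t *: f t.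
Proof.
move=> sxA; rewrite /linear_ext (big_fset_incl _ sxA) // => t _ tx.
by rewrite mcoeff_outdom // scale0r.
Qed.

Lemma linear_ext_is_linear (V : lmodType K) (f : T -> V) :
  linear (linear_ext f).
Proof.
move=> c x y; pose A := (msupp x `|` msupp y `|` msupp (c *: x + y))%fset.
have sA (z : {malg K[T]}) : z \in [:: x; y; c *: x + y] -> (msupp z `<=` A)%fset.
  by rewrite !inE => /or3P[] /eqP-> ; apply/fsubsetP => t tz;
    rewrite !inE tz ?orbT.
rewrite !(linear_extEw f (sA _ _)) ?inE ?eqxx ?orbT // scaler_sumr -big_split /=.
by apply: eq_bigr => t _; rewrite mcoeffD mcoeffZ scalerDl scalerA.
Qed.

HB.instance Definition _ (V : lmodType K) (f : T -> V) :=
  GRing.isLinear.Build K {malg K[T]} V _ (linear_ext f) (linear_ext_is_linear f).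

Lemma linear_extU (V : lmodType K) (f : T -> V) (t : T) :
  linear_ext f << t >> = f t.
Proof. by rewrite /linear_ext msuppU oner_eq0 big_seq_fset1 mcoeffU eqxx scale1r. Qed.

Lemma linear_eqU (V : lmodType K) (f g : {linear {malg K[T]} -> V}) :
  (forall t, f << t >> = g << t >>) -> f =1 g.
Proof.
move=> fg x; rewrite (monalgE x) !raddf_sum /=.
apply: eq_bigr => t _.
have -> : << x@_t *g t >> = x@_t *: << t >> :> {malg K[T]}.
  by apply/malgP => u; rewrite mcoeffZ !mcoeffU mulr_natr.
by rewrite !linearZ /= fg.
Qed.

End FreeModule.

Section Tensor.
Variables (K : fieldType) (T : choiceType).

(* K[T] (x) K[T] is the vector space with basis T * T; see [tensor_univ]. *)
Definition tensor (x y : {malg K[T]}) : {malg K[(T * T)%type]} :=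
  linear_ext (fun s => linear_ext (fun t => << (s, t) >>) y) x.

Lemma tensorU (s t : T) : tensor << s >> << t >> = << (s, t) >>.
Proof. by rewrite /tensor !linear_extU. Qed.

Lemma tensor_linearl (y : {malg K[T]}) : linear (tensor^~ y).
Proof. by move=> c x x'; rewrite /tensor linearP. Qed.

Lemma tensor_linearr (x : {malg K[T]}) : linear (tensor x).
Proof.
move=> c y y'; rewrite /tensor /linear_ext scaler_sumr -big_split /=.
by apply: eq_bigr => s _; rewrite -!/(linear_ext _ _) linearP scalerDr !scalerA mulrC.
Qed.

Lemma tensor_univ (V : lmodType K) (f : {malg K[T]} -> {malg K[T]} -> V) :
  (forall y, linear (f^~ y)) -> (forall x, linear (f x)) ->
  exists g : {linear {malg K[(T * T)%type]} -> V},
    (forall x y, g (tensor x y) = f x y) /\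
    (forall h : {linear {malg K[(T * T)%type]} -> V},
       (forall x y, h (tensor x y) = f x y) -> h =1 g).
Proof.
move=> fl fr; pose F (p : T * T) := f << p.1 >> << p.2 >>.
have gE x y : linear_ext F (tensor x y) = f x y.
  pose fly := GRing.isLinear.Build K {malg K[T]} V _ (f^~ y) (fl y).
  pose fyl : {linear {malg K[T]} -> V} := HB.pack (f^~ y) fly.
  pose gy := GRing.isLinear.Build K {malg K[T]} {malg K[(T * T)%type]} _
    (tensor^~ y) (tensor_linearl y).
  pose gyl : {linear {malg K[T]} -> {malg K[(T * T)%type]}} :=
    HB.pack (tensor^~ y) gy.
  apply: (@linear_eqU _ _ _ (linear_ext F \o gyl) fyl) => s /=.
  pose fx := GRing.isLinear.Build K {malg K[T]} V _ (f << s >>) (fr _).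
  pose fxl : {linear {malg K[T]} -> V} := HB.pack (f << s >>) fx.
  pose gx := GRing.isLinear.Build K {malg K[T]} {malg K[(T * T)%type]} _
    (tensor << s >>) (tensor_linearr _).
  pose gxl : {linear {malg K[T]} -> {malg K[(T * T)%type]}} :=
    HB.pack (tensor << s >>) gx.
  apply: (@linear_eqU _ _ _ (linear_ext F \o gxl) fxl) => t /=.
  by rewrite tensorU linear_extU.
exists (linear_ext F : {linear _ -> _}); split=> // h hE z.
have hU s t : h << (s, t) >> = linear_ext F << (s, t) >>.
  by rewrite -tensorU hE gE.
rewrite (monalgE z) !raddf_sum /=; apply: eq_bigr => -[s t] _.
have -> : << z@_(s, t) *g (s, t) >> = z@_(s, t) *: << (s, t) >>
    :> {malg K[(T * T)%type]}.
  by apply/malgP => u; rewrite mcoeffZ !mcoeffU mulr_natr.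
by rewrite !linearZ /= hU.
Qed.

Definition lin_span (V : lmodType K) (S : set V) : set V :=
  [set x | exists2 s : seq (K * V),
     (forall p, p \in s -> S p.2) & x = \sum_(p <- s) p.1 *: p.2].

Definition tensor_sub (C D : set {malg K[T]}) : set {malg K[(T * T)%type]} :=
  lin_span [set z | exists x y, [/\ C x, D y & z = tensor x y]].

Definition subspace (V : lmodType K) (C : set V) : Prop :=
  C 0 /\ forall (c : K) (x y : V), C x -> C y -> C (c *: x + y).

Definition subcoalgebra (D : {malg K[T]} -> {malg K[(T * T)%type]})
    (C : set {malg K[T]}) : Prop :=
  subspace C /\ forall x, C x -> tensor_sub C C (D x).

End Tensor.

Section Coproduct.
Variables (K : fieldType) (G : finGroupType).

Definition coproduct_basis (a : wreaths G) :
    {malg K[(wreaths G * wreaths G)%type]} :=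
  \sum_(i < (tag a).+1)
    << (Tagged (wreath G) (splitting (tagged a) i).1,
        Tagged (wreath G) (splitting (tagged a) i).2) >>.

Definition coproduct (x : {malg K[wreaths G]}) :
    {malg K[(wreaths G * wreaths G)%type]} :=
  linear_ext coproduct_basis x.

(* A graded set is a family E, and a graded map to it is a family rho. *)
Variables (E : nat -> choiceType) (rho : forall n, wreath G n -> E n).
Arguments rho {n}.

Definition restriction_property : Prop :=
  forall (n m : nat) (u : 'S_(n + m)), u \in shuffles n m ->
  forall (a1 a2 : wreath G n) (b1 b2 : wreath G m),
    rho a1 = rho a2 -> rho b1 = rho b2 ->
    rho (wcross a1 b1 * (of_perm G u)^-1)%g =
    rho (wcross a2 b2 * (of_perm G u)^-1)%g.

Definition fiber_sum (n : nat) (e : E n) : {malg K[wreaths G]} :=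
  \sum_(a : wreath G n | rho a == e) << Tagged (wreath G) a >>.

Definition fiber_span (n : nat) : set {malg K[wreaths G]} :=
  lin_span [set fiber_sum e | e in [set: E n]].

Definition fiber_space : set {malg K[wreaths G]} :=
  [set x | exists (N : nat) (y : nat -> {malg K[wreaths G]}),
     (forall n, fiber_span n (y n)) /\ x = \sum_(n < N) y n].

Definition restriction_set (n : nat) (e : E n) (i : nat)
    (b1 : wreath G i) (b2 : wreath G (n - i)) : {set wreath G n} :=
  [set a : wreath G n | (rho a == e) &&
    (wcross (splitting a i).1 (splitting a i).2 == wcross b1 b2)].

(* Under the restriction property the cardinal does not depend on the pair
   picked in the product of the two fibers. *)
Definition restriction_coef (n : nat) (e : E n) (i : nat)
    (e1 : E i) (e2 : E (n - i)) : nat :=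
  if [pick b : wreath G i * wreath G (n - i) |
       (rho b.1 == e1) && (rho b.2 == e2)] is Some b
  then #|restriction_set e b.1 b.2| else 0%N.

End Coproduct.

Arguments fiber_sum K {G E} rho {n} e.
Arguments fiber_span K {G E} rho n.
Arguments fiber_space K {G E} rho.

(* Main.v *)
Require Import Defs.
From mathcomp Require Import all_boot all_order all_algebra all_fingroup.
From mathcomp Require Import finmap monalg.
From mathcomp Require Import boolp classical_sets cardinality fsbigop.

Set Implicit Arguments.
Unset Strict Implicit.
Unset Printing Implicit Defensive.

Import GRing.Theory.
Local Open Scope ring_scope.

(** The terms of the coproduct of [fiber_sum e] in a fixed degree [i] are the
    pairs [splitting a i], for [a] in the fiber of [e].  By definition of the
    splitting, an element [a] lies over the pair [(b, c)] exactly when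
    [a = (b x c) u^-1] for a shuffle [u], and [u] is determined by [a].  So the
    pair [(b, c)] is obtained as many times as there are shuffles [u] with
    [rho ((b x c) u^-1) = e] ([card_restriction_set]).  The restriction property
    says that, [u] being fixed, this condition only involves [rho b] and
    [rho c]; hence the multiplicity of [(b, c)] is the coefficient
    [restriction_coef] taken at [(rho b, rho c)] ([restriction_coefE]).
    Collecting the pairs according to their images under [rho] turns the sum
    over the pairs [(b, c)] into the sum of the tensors of fiber sums
    ([sum_splitting_fiber]).

    The formula shows that the coproduct of a fiber sum lies in the tensor
    square of [fiber_space].  This tensor square is a subspace, the coproduct is
    linear and fiber sums span [fiber_space], so that [fiber_space] is a
    subcoalgebra. *)

(** * Sums over the fibers of a map *)

(** Only the values of [f] contribute, which is why the sum over the possibly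
    infinite type [J] has finite support. *)
Lemma sum_fibers (I : finType) (J : choiceType) (V : nmodType) (f : I -> J)
    (F : J -> I -> V) :
  \sum_(j \in [set: J]%classic) \sum_(i | f i == j) F j i = \sum_i F (f i) i.
Proof.
pose r := undup (codom f).
rewrite (fsbigE r) ?undup_uniq //; last first.
  move=> j _; rewrite mem_undup => jf; rewrite big1 // => i /eqP fij.
  by rewrite -fij codom_f in jf.
under eq_bigl => j do rewrite in_setT.
rewrite (exchange_big_dep xpredT) //=; apply: eq_bigr => i _.
rewrite (eq_bigl (pred1 (f i))) => [|j]; last by rewrite eq_sym.
by rewrite -big_filter filter_pred1_uniq ?big_seq1 ?undup_uniq // mem_undup codom_f.
Qed.

Lemma tensor_sum (K : fieldType) (T : choiceType) (I J : finType)
    (P : pred I) (Q : pred J) (s : I -> T) (t : J -> T) :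
  tensor (\sum_(i | P i) << s i >>) (\sum_(j | Q j) << t j >>) =
  \sum_(p | P p.1 && Q p.2) << (s p.1, t p.2) >> :> {malg K[(T * T)%type]}.
Proof.
rewrite /tensor linear_sum /=.
rewrite -(pair_big P Q (fun i j => << (s i, t j) >> : {malg K[(T * T)%type]})) /=.
apply: eq_bigr => i _; rewrite linear_extU linear_sum /=.
by apply: eq_bigr => j _; rewrite linear_extU.
Qed.

(** * Subspaces *)

Section Subspace.
Variables (K : fieldType) (V : lmodType K).
Implicit Types S C : set V.

Lemma lin_span_subspace S : subspace (lin_span S).
Proof.
split=> [|c x y [r rS ->] [t tS ->]]; first by exists [::]; rewrite ?big_nil.
exists ([seq (c * p.1, p.2) | p <- r] ++ t) => [p|].
  by rewrite mem_cat => /orP[/mapP[q qr ->]|]; [apply: rS q qr | apply: tS].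
rewrite big_cat big_map scaler_sumr /=; congr (_ + _).
by apply: eq_bigr => p _; rewrite scalerA.
Qed.

Lemma lin_span_mem S x : S x -> lin_span S x.
Proof.
move=> Sx; exists [:: (1, x)] => [p|]; first by rewrite inE => /eqP->.
by rewrite big_seq1 scale1r.
Qed.

Lemma subspaceZ C c x : subspace C -> C x -> C (c *: x).
Proof. by move=> [C0 CP] Cx; rewrite -[_ *: _]addr0; apply: CP. Qed.

Lemma subspace_sum C (I : Type) (r : seq I) (P : pred I) (F : I -> V) :
  subspace C -> (forall i, P i -> C (F i)) -> C (\sum_(i <- r | P i) F i).
Proof.
move=> [C0 CP] CF; apply: big_ind => // x y Cx Cy.
by rewrite -[x]scale1r; apply: CP.
Qed.

Lemma lin_span_min S C x :
  subspace C -> (forall y, S y -> C y) -> lin_span S x -> C x.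
Proof.
move=> Csub SC [r rS ->]; rewrite big_seq; apply: subspace_sum => // p pr.
by apply: subspaceZ => //; apply/SC/rS.
Qed.

End Subspace.

Lemma subspace_preim (K : fieldType) (V W : lmodType K)
    (f : {linear V -> W}) (D : set W) :
  subspace D -> subspace [set x | D (f x)]%classic.
Proof.
by move=> [D0 DP]; split=> [|c x y Dx Dy] /=; rewrite ?linear0 // linearP; apply: DP.
Qed.

(** * The multiplicity of a pair in the coproduct of a fiber sum *)

Section Fibers.
Variables (G : finGroupType) (E : nat -> choiceType).
Variable rho : forall n : nat, wreath G n -> E n.

Lemma of_perm_inj n : injective (@of_perm G n).
Proof. by move=> s t []. Qed.

(** The bijection from right to left sends a shuffle [u] to [(b x c) u^-1].  The length [k] is kept
    apart from [n + m], to which it is only provably equal in the use made of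
    the lemma; this is also why both sides of the equations live in the disjoint
    unions of the wreath products and of the [E n]. *)
Lemma card_unshuffle n m k (e : E k) (b : wreath G n) (c : wreath G m) :
  (n + m)%N = k ->
  #|[set a : wreath G k | (rho a == e) &&
      [exists u in shuffles n m,
         Tagged (wreath G) a^-1%g ==
         Tagged (wreath G) (of_perm G u * (wcross b c)^-1)%g]]| =
  #|[set u in shuffles n m |
      Tagged E (rho (wcross b c * (of_perm G u)^-1)%g) == Tagged E e]|.
Proof.
move=> nmk; case: k / nmk e => e.
pose f (u : 'S_(n + m)) := (wcross b c * (of_perm G u)^-1)%g.
have f_inj : injective f by move=> u v /mulgI/invg_inj/of_perm_inj.
rewrite -[RHS](card_imset _ f_inj); congr #|pred_of_set _|.
apply/setP => a; rewrite inE; apply/andP/imsetP => [[/eqP ae]|[u]].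
  case/exists_inP => u uX; rewrite eq_Tagged /= => /eqP aE.
  have aE' : a = f u by rewrite -[a]invgK aE invMg invgK.
  by exists u => //; rewrite inE uX eq_Tagged /= -/(f u) -aE' ae eqxx.
rewrite inE eq_Tagged /= -/(f u) => /andP[uX ue] ->; split=> //.
by apply/exists_inP; exists u => //; rewrite eq_Tagged /= invMg invgK.
Qed.

Lemma card_restriction_set n i (e : E n)
    (b : wreath G i) (c : wreath G (n - i)) : (i <= n)%N ->
  #|restriction_set rho e b c| =
  #|[set u in shuffles i (n - i) |
      Tagged E (rho (wcross b c * (of_perm G u)^-1)%g) == Tagged E e]|.
Proof.
move=> lein; rewrite -card_unshuffle ?subnKC //; apply: eq_card => a.
rewrite !inE; congr (_ && _); apply/eqP/exists_inP.
  case/wcross_inj => a1 a2; have : splitting a i = (b, c).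
    by rewrite [LHS]surjective_pairing a1 a2.
  by case/splittingP => // u uX /eqP; exists u.
case=> u uX /eqP aE; have [_ splitE] := splittingP a b c lein.
by rewrite splitE //; exists u.
Qed.

Lemma restriction_set_splitting n i (e : E n)
    (b : wreath G i * wreath G (n - i)) :
  restriction_set rho e b.1 b.2 =
  [set a | (rho a == e) && (splitting a i == b)].
Proof.
apply/setP => a; rewrite !inE; congr (_ && _).
apply/eqP/eqP => [/wcross_inj[]|-> //].
by case: (splitting a i) b => ? ? [? ?] /= -> ->.
Qed.

Hypothesis rhoRP : restriction_property rho.

(** The shuffles counted by [card_restriction_set] are the same for any two
    pairs with the same images, in particular for [(b, c)] and for the pair
    picked in the definition of the coefficient. *)
Lemma restriction_coefE n i (e : E n)
    (b : wreath G i) (c : wreath G (n - i)) : (i <= n)%N ->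
  restriction_coef rho e (rho b) (rho c) = #|restriction_set rho e b c|.
Proof.
move=> lein; rewrite /restriction_coef.
(* The none case is excluded by the pair [(b, c)] itself. *)
case: pickP => [[b' c'] /= /andP[/eqP bb /eqP cc]|/(_ (b, c))]; last first.
  by rewrite /= !eqxx.
rewrite !card_restriction_set //; congr #|pred_of_set _|; apply: eq_finset => u.
case: (boolP (u \in shuffles _ _)) => //= uX.
by rewrite (rhoRP uX bb cc).
Qed.

Variable K : fieldType.

(** Both sides are grouped by the pairs [b] of elements: on the left the terms
    [a] with [splitting a i = b], on the right the unique [p] that is the image
    of [b]. *)
Lemma sum_splitting_fiber n i (e : E n) : (i <= n)%N ->
  \sum_(a : wreath G n | rho a == e)
     << (Tagged (wreath G) (splitting a i).1,
         Tagged (wreath G) (splitting a i).2) >> =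
  \sum_(p \in [set: E i * E (n - i)%N]%classic)
    (restriction_coef rho e p.1 p.2)%:R *:
      tensor (fiber_sum K rho p.1) (fiber_sum K rho p.2).
Proof.
move=> lein.
pose U (b : wreath G i * wreath G (n - i)) :
    {malg K[(wreaths G * wreaths G)%type]} :=
  << (Tagged (wreath G) b.1, Tagged (wreath G) b.2) >>.
have tensorE p : (restriction_coef rho e p.1 p.2)%:R *:
      tensor (fiber_sum K rho p.1) (fiber_sum K rho p.2) =
    \sum_(b | (rho b.1, rho b.2) == p) (restriction_coef rho e p.1 p.2)%:R *: U b.
  by rewrite tensor_sum scaler_sumr; apply: eq_bigl => b; case: p.
under eq_fsbigr do rewrite tensorE.
rewrite (sum_fibers (fun b => (rho b.1, rho b.2))
  (fun p b => (restriction_coef rho e p.1 p.2)%:R *: U b)).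
rewrite (partition_big (fun a => splitting a i) xpredT) //=.
apply: eq_bigr => b _.
rewrite restriction_coefE // restriction_set_splitting scaler_nat -sumr_const.
by apply: eq_big => [a|a /andP[_ /eqP->]]; rewrite ?inE.
Qed.

Lemma coproduct_fiber_sum n (e : E n) :
  coproduct (fiber_sum K rho e) =
  \sum_(i < n.+1) \sum_(p \in [set: E i * E (n - i)%N]%classic)
    (restriction_coef rho e p.1 p.2)%:R *:
      tensor (fiber_sum K rho p.1) (fiber_sum K rho p.2).
Proof.
rewrite /coproduct /fiber_sum linear_sum /=.
under eq_bigr do rewrite linear_extU /coproduct_basis /=.
rewrite exchange_big /=; apply: eq_bigr => i _.
by rewrite sum_splitting_fiber // -ltnS.
Qed.

(** * The span of the fiber sums *)

Lemma fiber_span_subspace n : subspace (fiber_span K rho n).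
Proof. exact: lin_span_subspace. Qed.

(** A family over [i < N] is prolonged by [0], so that two elements given with
    different bounds can be combined over the larger one. *)
Lemma fiber_space_widen N M (y : nat -> {malg K[wreaths G]}) :
  (forall n, fiber_span K rho n (y n)) -> (N <= M)%N ->
  exists2 z : nat -> {malg K[wreaths G]},
    forall n, fiber_span K rho n (z n) & \sum_(n < N) y n = \sum_(n < M) z n.
Proof.
move=> yP NM; exists (fun n => if (n < N)%N then y n else 0) => [n|].
  by case: ifP => // _; case: (fiber_span_subspace n).
by rewrite -big_mkcond (big_ord_widen M y NM).
Qed.

Lemma fiber_space_subspace : subspace (fiber_space K rho).
Proof.
split=> [|c _ _ [N [y [yP ->]]] [M [z [zP ->]]]].
  by exists 0%N, (fun=> 0); split=> [n|]; [case: (fiber_span_subspace n) | rewrite big_ord0].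
have [y' y'P ->] := fiber_space_widen yP (leq_maxl N M).
have [z' z'P ->] := fiber_space_widen zP (leq_maxr N M).
exists (maxn N M), (fun n => c *: y' n + z' n); split=> [n|].
  by case: (fiber_span_subspace n) => _; apply.
by rewrite big_split scaler_sumr.
Qed.

(** In the graded sum the only nonzero term has degree [n]; it has to be
    transported from degree [k] along the equality [k = n]. *)
Lemma fiber_sum_space n (e : E n) : fiber_space K rho (fiber_sum K rho e).
Proof.
pose y k : {malg K[wreaths G]} :=
  if k =P n is ReflectT kn then fiber_sum K rho e else 0.
have yn : y n = fiber_sum K rho e by rewrite /y; case: eqP.
exists n.+1, y; split=> [k|].
  rewrite /y; case: eqP => [->|_]; last by case: (fiber_span_subspace k).
  by apply: lin_span_mem; exists e.
rewrite big_ord_recr /= yn big1 ?add0r // => -[k kn] _ /=.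
by rewrite /y; case: eqP => // kn'; rewrite kn' ltnn in kn.
Qed.

Lemma fiber_space_min (C : set {malg K[wreaths G]}) x :
  subspace C -> (forall n (e : E n), C (fiber_sum K rho e)) ->
  fiber_space K rho x -> C x.
Proof.
move=> Csub CE [N [y [yP ->]]]; apply: subspace_sum => // n _.
by apply: lin_span_min (yP n) => // _ [e _ <-].
Qed.

Lemma fiber_space_subcoalgebra :
  subcoalgebra (@coproduct K G) (fiber_space K rho).
Proof.
split=> [|x]; first exact: fiber_space_subspace.
have tensor_subspace := lin_span_subspace
  [set z | exists x y, [/\ fiber_space K rho x, fiber_space K rho y &
                          z = tensor x y]]%classic.
apply: (fiber_space_min
  (@subspace_preim _ _ _ (linear_ext (@coproduct_basis K G)) _ tensor_subspace)).
move=> n e /=; rewrite -/(coproduct _) coproduct_fiber_sum.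
apply: subspace_sum => // i _; apply: subspace_sum => // p _.
apply: subspaceZ => //; apply: lin_span_mem.
exists (fiber_sum K rho p.1), (fiber_sum K rho p.2).
by split; [exact: fiber_sum_space | exact: fiber_sum_space |].
Qed.

End Fibers.

Theorem theorem3p6 (K : fieldType) (charK0 : [pchar K] =i pred0)
    (G : finGroupType) (abelG : abelian [set: G])
    (E : nat -> choiceType) (rho : forall n : nat, wreath G n -> E n)
    (rhoRP : restriction_property rho) :
  (forall (n : nat) (e : E n),
     coproduct (fiber_sum K rho e) =
     \sum_(i < n.+1) \sum_(p \in [set: E i * E (n - i)%N]%classic)
       (restriction_coef rho e p.1 p.2)%:R *:
         tensor (fiber_sum K rho p.1) (fiber_sum K rho p.2)) /\
  subcoalgebra (@coproduct K G) (fiber_space K rho).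
Proof.
split=> [n e|]; first exact: coproduct_fiber_sum.
exact: fiber_space_subcoalgebra.
Qed.
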